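(* Let $$P(s)=\frac{\beta_0 s+\beta_1}{(s-p_1)(s-p_2)},\qquad \operatorname{Re}(p_1)>0,\ \operatorname{Re}(p_2)>0,$$ where $\beta_0\ge0$, $\beta_1>0$ are real and $p_1,p_2$ are either both real or a complex conjugate pair. Then the following hold. (i) If $\beta_0=0$, no proportional controller stabilizes $P$ (so $k_M^{P}$ does not exist); if $\beta_0\neq0$, then $k_M^{P}=\infty$. In both cases $k_M^{PID}=k_M^{PD}=\infty$. (ii) If $\beta_0=0$, then $\theta_M^{P}$ does not exist (no proportional controller stabilizes $P$) and $\theta_M^{PID}=\theta_M^{PD}=\pi/2$. If $\beta_0\ne0$, then $\theta_M^{P}=\pi/2$ and $\theta_M^{PID}=\theta_M^{PD}=\pi$.
   Context: Controllers: $K_P(s)=k_p$; $K_{PD}(s)=k_p+k_d s$; $K_{PID}(s)=k_p+k_i/s+k_d s$, with real coefficients (possibly zero). Stabilization (unity negative feedback): write the plant as $P=N_P/D_P$ with numerator and denominator polynomials exactly as displayed (no cancellation of common factors is performed) and a controller as $K=N_K/D_K$ with $N_K,D_K$ coprime real polynomials. For a nonzero complex number $c$, $K$ stabilizes $cP$ if $\deg(N_PN_K)\le\deg(D_PD_K)$ and the closed-loop characteristic polynomial $D_PD_K+cN_PN_K$ has degree $\deg(D_PD_K)$ and all its roots in the open left half-plane. Margins: for a controller type $X\in\{P,PD,PID\}$, $k_M^{X}=\sup\{\mu:\ \exists K \text{ of type } X \text{ stabilizing } \alpha P \text{ for all }\alpha\in[1,\mu)\}$ and $\theta_M^{X}=\sup\{\eta\in[0,\pi]:\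 \exists K\text{ of type }X\text{ stabilizing } e^{-j\theta}P\text{ for all }\theta\in(-\eta,\eta)\}$, where $j=\sqrt{-1}$; one and the same controller must work for the whole range of $\alpha$ (resp. $\theta$). *)

(* Defs.v *)
From mathcomp Require Import all_boot all_order all_algebra.
From mathcomp Require Import all_classical all_reals all_analysis.
From mathcomp Require Import complex.

Set Implicit Arguments.
Unset Strict Implicit.
Unset Printing Implicit Defensive.

Import Order.TTheory GRing.Theory Num.Theory.

Local Open Scope ring_scope.
Local Open Scope complex_scope.
Local Open Scope classical_set_scope.

(* A plant is a pair of polynomials, not a fraction: common factors of the
   numerator and the denominator must be kept.  Coefficients are complex so
   that a denominator can be given by its (possibly nonreal) roots. *)
Record plant (R : realType) := Plant {
  plant_num : {poly R[i]};
  plant_den : {poly R[i]} }.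

Inductive controller_type := TypeP | TypePD | TypePID.

(* Controllers are elements of the field R(s) of real rational functions. *)
Definition controller (R : realType) := {fraction {poly R}}.

Definition K_P (R : realType) (kp : R) : controller R :=
  tofrac kp%:P.

Definition K_PD (R : realType) (kp kd : R) : controller R :=
  tofrac kp%:P + tofrac kd%:P * tofrac 'X.

Definition K_PID (R : realType) (kp ki kd : R) : controller R :=
  tofrac kp%:P + tofrac ki%:P / tofrac 'X + tofrac kd%:P * tofrac 'X.

Definition of_type (R : realType) (X : controller_type) : set (controller R) :=
  match X with
  | TypeP => [set K | exists kp, K = K_P kp]
  | TypePD => [set K | exists kp kd, K = K_PD kp kd]
  | TypePID => [set K | exists kp ki kd, K = K_PID kp ki kd]
  end.

Definition complexify (R : realType) (p : {poly R}) : {poly R[i]} :=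
  map_poly (real_complex R) p.

(* K stabilizes c P.  A coprime representation of K is unique up to a nonzero
   real factor, which affects none of the conditions.  Degrees are compared
   through size (degree + 1, and 0 for the zero polynomial). *)
Definition stabilizes (R : realType) (K : controller R) (c : R[i])
    (P : plant R) : Prop :=
  exists NK DK : {poly R},
    [/\ coprimep NK DK, DK != 0 & K = tofrac NK / tofrac DK] /\
    let N := plant_num P * complexify NK in
    let D := plant_den P * complexify DK in
    [/\ (size N <= size D)%N,
        size (D + c *: N) = size D &
        forall z : R[i], root (D + c *: N) z -> complex.Re z < 0].

Definition stabilizable (R : realType) (X : controller_type) (P : plant R) :=
  exists2 K : controller R, of_type X K & stabilizes K 1 P.

Definition expNi (R : realType) (theta : R) : R[i] :=
  cos theta -i* sin theta.

Definition gain_margin (R : realType) (X : controller_type) (P : plant R)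
    : \bar R :=
  ereal_sup [set mu%:E | mu in [set mu : R |
    exists2 K : controller R, of_type X K &
      forall alpha : R, 1 <= alpha < mu -> stabilizes K alpha%:C P]].

Definition phase_margin (R : realType) (X : controller_type) (P : plant R)
    : R :=
  sup [set eta : R | 0 <= eta <= pi /\
    exists2 K : controller R, of_type X K &
      forall theta : R, - eta < theta < eta -> stabilizes K (expNi theta) P].

(* The sets above always contain mu = 1 and eta = 0, for which the range of
   perturbations is empty; a margin is said to exist only when the nominal
   plant can be stabilized by a controller of the given type. *)
Definition is_gain_margin (R : realType) (X : controller_type) (P : plant R)
    (k : \bar R) : Prop :=
  stabilizable X P /\ gain_margin X P = k.

Definition is_phase_margin (R : realType) (X : controller_type) (P : plant R)
    (t : R) : Prop :=
  stabilizable X P /\ phase_margin X P = t.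

Definition second_order_plant (R : realType) (beta0 beta1 : R) (p1 p2 : R[i])
    : plant R :=
  Plant (beta0%:C *: 'X + (beta1%:C)%:P) (('X - p1%:P) * ('X - p2%:P)).

(* Main.v *)
(* For K = Q/s, a closed-loop pole is a root of s D_P + c N_P Q.  If
   deg N_P Q <= deg D_P, minus the sum of the roots of this monic polynomial
   is -a + c r, with a = p1 + p2 and r the real coefficient of s^2 in N_P Q;
   stability forces a <= r Re c.  This rules out r = 0 at c = 1 (proportional
   control when beta0 = 0) and c = -j (phase margins above pi/2).
   Conversely, for proportional control, and for PD control when beta0 = 0,
   the characteristic polynomial is a complex monic quadratic and the Hurwitz
   determinant is positive at high gain as long as Re c stays away from 0.
   When beta0 > 0, the controller k (beta0 s + beta1) doubles the stable zero
   of the plant: in the closed right half-plane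
   k |beta0 s + beta1|^2 > |D_P(s)| for large k, whatever the phase of c. *)
Require Import Defs.
From mathcomp Require Import all_boot all_order all_algebra.
From mathcomp Require Import all_classical all_reals all_analysis.
From mathcomp Require Import complex ring lra.

Set Implicit Arguments.
Unset Strict Implicit.
Unset Printing Implicit Defensive.

Import Order.TTheory GRing.Theory Num.Theory.

Local Open Scope ring_scope.
Local Open Scope complex_scope.

(** * Necessary condition from the sum of the closed-loop poles *)

(** By Vieta, the subleading coefficient is minus the sum of the roots, taken with multiplicity. *)
Lemma monic_Re_coef_ge0 (R : realType) (n : nat) (G : {poly R[i]}) :
  G \is monic -> size G = n.+2 ->
  (forall z, root G z -> complex.Re z <= 0) -> 0 <= complex.Re G`_n.
Proof.
move=> /monicP Glead szG rootG.
have [r Gr] := closed_field_poly_normal G.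
rewrite Glead scale1r in Gr.
have szr : size r = n.+1 by move: szG; rewrite Gr size_prod_XsubC => -[].
have -> : G`_n = - \sum_(z <- r) z.
  by rewrite Gr -coefPn_prod_XsubC szr.
have : {in r, forall z, complex.Re z <= 0}.
  by move=> z zr; apply: rootG; rewrite Gr root_prod_XsubC.
elim: r {Gr szr} => [|z r IHr] rle; first by rewrite big_nil oppr0.
rewrite big_cons opprD raddfD /= addr_ge0 //.
  by rewrite raddfN oppr_ge0 rle ?mem_head.
by apply: IHr => w wr; apply: rle; rewrite in_cons wr orbT.
Qed.

(* The pole at 0 of [Q / 'X] may cancel, so a root of
   ['X * plant_den P + c * plant_num P * Q] is only known to be 0 or a
   closed-loop pole; the weak inequality on the real part is all one needs. *)
Lemma stabilizes_Re_coef_ge0 (R : realType) (n : nat) (Q : {poly R})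
    (K : controller R) (c : R[i]) (P : plant R) :
  K = tofrac Q / tofrac 'X ->
  plant_den P \is monic -> size (plant_den P) = n.+2 ->
  (size (plant_num P * complexify Q)%R <= n.+2)%N ->
  stabilizes K c P ->
  0 <= complex.Re ((plant_den P)`_n + c * (plant_num P * complexify Q)`_n.+1).
Proof.
case: P => NP DP /= defK DPmonic szDP szNQ [NK [DK [[_ DK0 KE] /= [_ _ rootF]]]].
set F := _ + _ in rootF.
pose T := c *: (NP * complexify Q).
pose G := 'X * DP + T.
have NKX : NK * 'X = Q * DK.
  apply/eqP; rewrite -tofrac_eq !tofracM.
  by rewrite -eqr_div ?tofrac_eq0 ?polyX_eq0 // -KE defK.
have FG : F * 'X = G * complexify DK.
  have E : complexify NK * 'X = complexify Q * complexify DK.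
    by rewrite /complexify -rmorphM /= -NKX rmorphM /= map_polyX.
  rewrite /F /G /T mulrDl -scalerAl -(mulrA NP (complexify NK)) E.
  by rewrite mulrDl -scalerAl; congr (_ + _); [ring | rewrite mulrA].
(* [T] has degree at most [n + 1] and ['X * DP] is monic of degree [n + 2], so [G] keeps its leading
   term. *)
have szT : (size T <= n.+2)%N by apply: leq_trans (size_scale_leq _ _) szNQ.
have szXD : size ('X * DP) = n.+3.
  by rewrite mulrC size_mulX ?szDP // monic_neq0.
have szG : size G = n.+3 by rewrite size_polyDl szXD.
have Gmonic : G \is monic.
  by rewrite monicE lead_coefDl ?szXD // lead_coefM lead_coefX mul1r -monicE.
have -> : DP`_n + c * (NP * complexify Q)`_n.+1 = G`_n.+1.
  by rewrite coefD coefXM /= coefZ.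
apply: monic_Re_coef_ge0 => // z Gz.
have : root (F * 'X) z by rewrite FG rootM Gz.
by rewrite rootM => /orP[/rootF/ltW //|]; rewrite rootX => /eqP->.
Qed.

(** * Root location for quadratics *)

(* The second hypothesis is the second Hurwitz determinant of a monic
   quadratic with complex coefficients [A = a1 + i a2], [B = b1 + i b2]. *)
Lemma complex_quadratic_Hurwitz (R : realType) (A B z : R[i]) :
  0 < complex.Re A ->
  complex.Im B ^+ 2 < complex.Re A *
    (complex.Re A * complex.Re B + complex.Im A * complex.Im B) ->
  z ^+ 2 + A * z + B = 0 -> complex.Re z < 0.
Proof.
case: A B z => [a1 a2] [b1 b2] [x y] /= a1_gt0 det_gt0.
rewrite expr2 => /eqP; rewrite eq_complex /= => /andP[/eqP re0 /eqP im0].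
rewrite ltNge; apply/negP => x_ge0.
(* Times [a1 ^+ 2], this is four times the positive Hurwitz determinant plus a square. *)
have disc_gt0 : 0 < 4 * b1 + a2 ^+ 2.
  rewrite -(pmulr_rgt0 _ (exprn_gt0 2 a1_gt0)).
  have := sqr_ge0 (2 * b2 - a1 * a2); nra.
have yE : y * (2 * x + a1) = - (a2 * x + b2) by lra.
(* Eliminating [y] leaves a quartic in [x]. Its constant term is the Hurwitz determinant and its
   other coefficients are positive, so it has no root [x >= 0]. *)
have : (x ^+ 2 + a1 * x + b1) * (2 * x + a1) ^+ 2 - (a2 * x + b2) ^+ 2
       + a2 * (a2 * x + b2) * (2 * x + a1) = 0.
  have re0' : x ^+ 2 + a1 * x + b1 = y ^+ 2 + a2 * y by lra.
  rewrite re0' -[a2 * x + b2]opprK -yE; ring.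
have -> : (x ^+ 2 + a1 * x + b1) * (2 * x + a1) ^+ 2 - (a2 * x + b2) ^+ 2
       + a2 * (a2 * x + b2) * (2 * x + a1)
  = (a1 * (a1 * b1 + a2 * b2) - b2 ^+ 2)
    + a1 * (a1 ^+ 2 + (4 * b1 + a2 ^+ 2)) * x
    + (5 * a1 ^+ 2 + (4 * b1 + a2 ^+ 2)) * x ^+ 2
    + 8 * a1 * x ^+ 3 + 4 * x ^+ 4 by ring.
apply/eqP; rewrite gt_eqF //.
have a1sq : 0 < a1 ^+ 2 by rewrite exprn_gt0.
do 4 (apply: ltr_wpDr; first by rewrite ?mulr_ge0 ?exprn_ge0 //; lra).
by rewrite subr_gt0.
Qed.

(** At a root, [z ^+ 2 - a z + b] and [k (b0 z + b1) ^+ 2] have equal moduli, since [c] has modulus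
    1. The three lower bounds on [k] make the second larger when [Re z >= 0]. *)
Lemma high_gain_square_root_lt0 (R : realType) (a b b0 b1 k : R) (c z : R[i]) :
  0 < b -> 0 < b0 -> 0 < b1 -> 0 <= k ->
  2 <= k * b0 ^+ 2 -> 2 * b <= k * b1 ^+ 2 -> 2 * `|a| <= k * (b0 * b1) ->
  complex.Re c ^+ 2 + complex.Im c ^+ 2 = 1 ->
  z ^+ 2 - a%:C * z + b%:C + c * (k%:C * (b0%:C * z + b1%:C) ^+ 2) = 0 ->
  complex.Re z < 0.
Proof.
case: c z => [C S] [x y] /= b_gt0 b0_gt0 b1_gt0 k_ge0 k0 k1 ka CS.
rewrite !expr2 => /eqP; rewrite eq_complex /= => /andP[/eqP re0 /eqP im0].
rewrite ltNge; apply/negP => x_ge0.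
(* Here [u] and [r] are the squared moduli of [b0 z + b1] and [z], and [d1 + i d2] is
   [z ^+ 2 - a z + b]. *)
pose u := (b0 * x + b1) ^+ 2 + (b0 * y) ^+ 2.
pose r := x ^+ 2 + y ^+ 2.
pose d1 := x ^+ 2 - y ^+ 2 - a * x + b.
pose d2 := 2 * x * y - a * y.
have du : d1 ^+ 2 + d2 ^+ 2 = (k * u) ^+ 2.
  pose w1 := k * ((b0 * x + b1) ^+ 2 - (b0 * y) ^+ 2).
  pose w2 := k * (2 * (b0 * x + b1) * (b0 * y)).
  have -> : d1 = - (C * w1 - S * w2).
    by apply/eqP; rewrite -subr_eq0 -re0; apply/eqP; rewrite /d1 /w1 /w2; ring.
  have -> : d2 = - (C * w2 + S * w1).
    by apply/eqP; rewrite -subr_eq0 -im0; apply/eqP; rewrite /d2 /w1 /w2; ring.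
  transitivity ((C ^+ 2 + S ^+ 2) * (w1 ^+ 2 + w2 ^+ 2)); first by ring.
  by rewrite CS /w1 /w2 /u; ring.
(* [3 sum |v_i|^2 - |sum v_i|^2 = sum_(i < j) |v_i - v_j|^2] for the terms
   [v_i] = [z ^+ 2], [- a z], [b]. *)
have d_le : d1 ^+ 2 + d2 ^+ 2 <= 3 * (r ^+ 2 + a ^+ 2 * r + b ^+ 2).
  rewrite -subr_ge0.
  have -> : 3 * (r ^+ 2 + a ^+ 2 * r + b ^+ 2) - (d1 ^+ 2 + d2 ^+ 2)
    = (x ^+ 2 - y ^+ 2 + a * x) ^+ 2 + (2 * x * y + a * y) ^+ 2
      + ((x ^+ 2 - y ^+ 2 - b) ^+ 2 + (2 * x * y) ^+ 2)
      + ((a * x + b) ^+ 2 + (a * y) ^+ 2) by rewrite /r /d1 /d2; ring.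
  by rewrite !addr_ge0 ?sqr_ge0.
have r_ge0 : 0 <= r by rewrite addr_ge0 ?sqr_ge0.
(* The assumption [0 <= x] enters through the cross term. *)
have u_ge : b0 ^+ 2 * r + b1 ^+ 2 <= u.
  have : 0 <= 2 * b0 * b1 * x by rewrite !mulr_ge0 // ltW.
  by rewrite /u /r; lra.
pose s := k * b0 ^+ 2 * r + k * b1 ^+ 2.
have s_ge0 : 0 <= s.
  by apply: addr_ge0; [apply: mulr_ge0 => //; lra | lra].
have ku_ge : s <= k * u.
  have -> : s = k * (b0 ^+ 2 * r + b1 ^+ 2) by rewrite /s; ring.
  exact: ler_wpM2l.
have s_le : s ^+ 2 <= (k * u) ^+ 2.
  by rewrite ler_sqr ?nnegrE // (le_trans s_ge0).
(* The squared gain bounds give factors 4, 8, 4 against the factor 3 of [d_le]; [0 < b] makes the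
   contradiction strict. *)
have : 4 * r ^+ 2 + 8 * a ^+ 2 * r + 4 * b ^+ 2 <= s ^+ 2.
  have -> : s ^+ 2 = (k * b0 ^+ 2) ^+ 2 * r ^+ 2
    + 2 * (k * (b0 * b1)) ^+ 2 * r + (k * b1 ^+ 2) ^+ 2 by rewrite /s; ring.
  have sq (p q : R) : 0 <= p -> p <= q -> p ^+ 2 <= q ^+ 2.
    by move=> p0 pq; rewrite ler_sqr ?nnegrE // (le_trans p0).
  have q0 := sq _ _ (ler0n R 2) k0.
  have q1 := sq _ _ (mulr_ge0 (ler0n R 2) (ltW b_gt0)) k1.
  have qa := sq _ _ (mulr_ge0 (ler0n R 2) (normr_ge0 a)) ka.
  have {}qa : 4 * a ^+ 2 <= (k * (b0 * b1)) ^+ 2.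
    by move: qa; rewrite exprMn real_normK ?num_real //; lra.
  have {}q0 := ler_wpM2r (sqr_ge0 r) q0.
  have {}qa := ler_wpM2r r_ge0 qa.
  by move: q0 q1 qa; lra.
have ar_ge0 : 0 <= a ^+ 2 * r by rewrite mulr_ge0 ?sqr_ge0.
have := exprn_gt0 2 b_gt0; have := sqr_ge0 r; move: d_le s_le; rewrite du; lra.
Qed.

(** The right side of the determinant condition grows like [k ^+ 3], the left like [k ^+ 2];
    [e <= C] makes one gain work for all these phases. *)
Lemma Routh_gain_exists (R : realType) (a b b0 b1 e : R) :
  0 < a -> 0 < b -> 0 < b0 -> 0 < b1 -> 0 < e ->
  exists2 k, 0 < k & forall C S, e <= C -> C ^+ 2 + S ^+ 2 = 1 ->
    0 < - a + k * b0 * C /\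
    (k * b1 * S) ^+ 2 < (- a + k * b0 * C) *
      ((- a + k * b0 * C) * (b + k * b1 * C) + (k * b0 * S) * (k * b1 * S)).
Proof.
move=> a_gt0 b_gt0 b0_gt0 b1_gt0 e_gt0.
have be_gt0 : 0 < b0 * e by rewrite mulr_gt0.
have bbe_gt0 : 0 < b0 ^+ 2 * e by rewrite mulr_gt0 ?exprn_gt0.
have t1 : 0 <= 2 * a / (b0 * e) by rewrite divr_ge0 ?mulr_ge0 // ltW.
have t2 : 0 <= 2 * b / b1 by rewrite divr_ge0 ?mulr_ge0 // ltW.
have t3 : 0 <= 8 * b1 / (b0 ^+ 2 * e).
  by rewrite divr_ge0 ?mulr_ge0 ?sqr_ge0 // ltW.
(* The summands yield [k1], [k2] and [k3] in turn; the final 1 gives strictness in [k3]. *)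
pose k := 2 * a / (b0 * e) + 2 * b / b1 + 8 * b1 / (b0 ^+ 2 * e) + 1.
have k_gt0 : 0 < k by rewrite /k; lra.
exists k => // C S eC CS.
have k1 : 2 * a <= k * (b0 * e) by rewrite -ler_pdivrMr // /k; lra.
have k2 : 2 * b <= k * b1 by rewrite -ler_pdivrMr // /k; lra.
have k3 : 8 * b1 < k * (b0 ^+ 2 * e) by rewrite -ltr_pdivrMr // /k; lra.
have C_gt0 : 0 < C by exact: lt_le_trans eC.
have kb0_gt0 : 0 < k * b0 by rewrite mulr_gt0.
have kb1_gt0 : 0 < k * b1 by rewrite mulr_gt0.
have S2_le1 : S ^+ 2 <= 1 by have := sqr_ge0 C; lra.
have C_le1 : C <= 1.
  by rewrite -(@expr_le1 _ 2) ?(ltW C_gt0) //; have := sqr_ge0 S; lra.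
have keC : k * (b0 * e) <= k * b0 * C by rewrite mulrA ler_pM2l.
have kC : k * b0 * C <= k * b0 by rewrite ger_pMr.
have A_ge : k * (b0 * e) / 2 <= - a + k * b0 * C by lra.
have ke_gt0 : 0 < k * (b0 * e) by rewrite mulr_gt0.
have A_gt0 : 0 < - a + k * b0 * C by lra.
split=> //.
pose M := (- a + k * b0 * C) * (b + k * b1 * C) + (k * b0 * S) * (k * b1 * S).
(* Since [C ^+ 2 + S ^+ 2 = 1], the leading term is [k ^+ 2 * b0 * b1]; [a * b] costs at most a
   quarter of it and [a * k * b1 * C] at most half. *)
have M_ge : k * b0 * (k * b1) / 4 <= M.
  have -> : M = k * b0 * (k * b1) + k * b0 * C * b - a * b - a * (k * b1) * C.
    have S2 : S ^+ 2 = 1 - C ^+ 2 by lra.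
    transitivity (- a * b - a * (k * b1) * C + k * b0 * C * b
      + k * b0 * (k * b1) * (C ^+ 2 + S ^+ 2)); first by rewrite /M; ring.
    by rewrite CS; ring.
  have h1 : 0 <= k * b0 * C * b by rewrite !mulr_ge0 // ltW.
  have h2 : a * (k * b1) * C <= a * (k * b1).
    by rewrite ger_pMr // mulr_gt0.
  have h3 : 2 * a * (k * b1) <= k * b0 * (k * b1).
    by rewrite ler_pM2r //; lra.
  have h4 : 2 * a * (2 * b) <= k * b0 * (k * b1) by apply: ler_pM; lra.
  lra.
have M0 : 0 < k * b0 * (k * b1) / 4 by rewrite divr_gt0 // mulr_gt0.
apply: (@lt_le_trans _ _ ((k * (b0 * e) / 2) * (k * b0 * (k * b1) / 4))); last first.
  by apply: ler_pM => //; lra.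
apply: (@le_lt_trans _ _ ((k * b1) ^+ 2)).
  by rewrite exprMn ger_pMr // exprn_gt0.
have -> : k * (b0 * e) / 2 * (k * b0 * (k * b1) / 4)
    = (k * b1) * k * (k * (b0 ^+ 2 * e) / 8) by field.
have -> : (k * b1) ^+ 2 = k * b1 * k * b1 by ring.
by rewrite ltr_pM2l ?mulr_gt0 //; lra.
Qed.

(** * Controllers and closed-loop polynomials *)

Lemma K_P_PD (R : realType) (kp : R) : K_P kp = K_PD kp 0.
Proof. by rewrite /K_PD polyC0 tofrac0 mul0r addr0. Qed.

Lemma K_PD_PID (R : realType) (kp kd : R) : K_PD kp kd = K_PID kp 0 kd.
Proof. by rewrite /K_PID polyC0 tofrac0 mul0r addr0. Qed.

Lemma of_type_P_PD (R : realType) (K : controller R) :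
  of_type TypeP K -> of_type TypePD K.
Proof. by case=> kp ->; exists kp, 0; exact: K_P_PD. Qed.

Lemma of_type_PD_PID (R : realType) (K : controller R) :
  of_type TypePD K -> of_type TypePID K.
Proof. by case=> kp [kd ->]; exists kp, 0, kd; exact: K_PD_PID. Qed.

Lemma K_PID_fraction (R : realType) (kp ki kd : R) :
  K_PID kp ki kd = tofrac (ki%:P + kp%:P * 'X + kd%:P * 'X^2) / tofrac 'X.
Proof.
have X0 : tofrac 'X != 0 :> controller R by rewrite tofrac_eq0 polyX_eq0.
rewrite /K_PID; apply: (mulIf X0); rewrite divfK //.
rewrite !mulrDl divfK // !tofracD !tofracM; ring.
Qed.

Lemma second_order_denE (R : realType) (p1 p2 : R[i]) :
  0 < complex.Re p1 -> 0 < complex.Re p2 ->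
  (complex.Im p1 = 0 /\ complex.Im p2 = 0) \/ p2 = conjc p1 ->
  exists a b : R, [/\ 0 < a, 0 < b &
    ('X - p1%:P) * ('X - p2%:P) = 'X^2 - a%:C%:P * 'X + b%:C%:P].
Proof.
case: p1 p2 => [x1 y1] [x2 y2] /= x1_gt0 x2_gt0 hp.
(* These are the real parts of [p1 + p2] and [p1 * p2], both real in either case. *)
exists (x1 + x2), (x1 * x2 - y1 * y2); split; first exact: addr_gt0.
  by case: hp => [[-> ->]|[-> ->]]; nra.
have -> : (x1 + x2)%:C = x1 +i* y1 + (x2 +i* y2).
  by apply/eqP; rewrite eq_complex /= eqxx; case: hp => [[-> ->]|[_ ->]];
    apply/eqP; ring.
have -> : (x1 * x2 - y1 * y2)%:C = (x1 +i* y1) * (x2 +i* y2).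
  by apply/eqP; rewrite eq_complex /= eqxx; case: hp => [[-> ->]|[-> ->]];
    apply/eqP; ring.
by rewrite polyCD polyCM; ring.
Qed.

(** A PD controller is a polynomial, with coprime denominator 1. The closed loop has leading
    coefficient [1 + c * (b0 * kd)], so its degree stays 2 when this is nonzero. *)
Lemma stabilizes_PD (R : realType) (kp kd a b b0 b1 : R) (c p1 p2 : R[i]) :
  ('X - p1%:P) * ('X - p2%:P) = 'X^2 - a%:C%:P * 'X + b%:C%:P ->
  1 + c * (b0 * kd)%:C != 0 ->
  (forall z : R[i], z ^+ 2 - a%:C * z + b%:C
     + c * ((b0%:C * z + b1%:C) * (kp%:C + kd%:C * z)) = 0 ->
   complex.Re z < 0) ->
  stabilizes (K_PD kp kd) c (second_order_plant b0 b1 p1 p2).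
Proof.
move=> denE lead0 rootP.
exists (kp%:P + kd%:P * 'X), 1; split.
  split; rewrite ?coprimep1 ?oner_eq0 //.
  by rewrite /K_PD tofracD tofracM tofrac1 divr1.
have -> : complexify 1 = 1 :> {poly R[i]} by rewrite /complexify rmorph1.
have -> : complexify (kp%:P + kd%:P * 'X) = kp%:C%:P + kd%:C%:P * 'X.
  by rewrite /complexify rmorphD rmorphM /= !map_polyC map_polyX.
rewrite mulr1 /=.
set N := _ * (_ + _); set D := _ * _.
have size_linear (u v : R[i]) : (size (u%:P * 'X + v%:P)%R <= 2)%N.
  by rewrite size_MXaddC; case: ifP => // _; rewrite ltnS size_polyC_leq1.
have szD : size D = 3.
  by rewrite size_monicM ?monicXsubC ?polyXsubC_eq0 // !size_XsubC.
split.
- rewrite szD (leq_trans (size_polyMleq _ _)) // -subn1 leq_subLR.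
  by rewrite (@leq_add _ _ 2 2) // -?mul_polyC // addrC.
- rewrite szD.
  have -> : D + c *: N = ((1 + c * (b0 * kd)%:C)%:P * 'X
      + (- a%:C + c * (b0%:C * kp%:C + b1%:C * kd%:C))%:P) * 'X
      + (b%:C + c * b1%:C * kp%:C)%:P.
    rewrite /D denE /N -!mul_polyC rmorphM /= !polyCD !polyCN !polyCM.
    by rewrite polyCD !polyCM; ring.
  by rewrite !size_MXaddC !polyC_eq0 (negPf lead0) /= -size_poly_eq0
    size_MXaddC polyC_eq0 (negPf lead0) size_polyC lead0.
move=> z; rewrite /root /D denE !hornerE => /eqP Dz.
by apply: rootP; rewrite -Dz /N !hornerE; ring.
Qed.

Lemma stabilizes_pole_sum_le (R : realType) (a b beta0 beta1 : R) (Q : {poly R})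
    (K : controller R) (c p1 p2 : R[i]) :
  ('X - p1%:P) * ('X - p2%:P) = 'X^2 - a%:C%:P * 'X + b%:C%:P ->
  K = tofrac Q / tofrac 'X ->
  (size ((beta0 *: 'X + beta1%:P) * Q)%R <= 3)%N ->
  stabilizes K c (second_order_plant beta0 beta1 p1 p2) ->
  a <= complex.Re c * ((beta0 *: 'X + beta1%:P) * Q)`_2.
Proof.
move=> denE KE szQ st.
set r := _`_2.
have NE : (beta0%:C *: 'X + beta1%:C%:P) * complexify Q
    = complexify ((beta0 *: 'X + beta1%:P) * Q).
  by rewrite /complexify rmorphM rmorphD /= map_polyZ map_polyX map_polyC.
have := @stabilizes_Re_coef_ge0 R 1 Q K c _ KE _ _ _ st.
rewrite /= monicMl ?monicXsubC // NE size_map_poly.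
rewrite size_monicM ?monicXsubC ?polyXsubC_eq0 // !size_XsubC.
move=> /(_ isT erefl szQ).
rewrite denE /complexify coef_map -/r !coefE /=.
case: c {st} => u v /=; lra.
Qed.

(** * From perturbation ranges to margins *)

Lemma stabilizable_of_phase_range (R : realType) (X : controller_type)
    (P : plant R) (eta : R) (K : controller R) :
  0 < eta -> of_type X K ->
  (forall theta, - eta < theta < eta -> stabilizes K (expNi theta) P) ->
  stabilizable X P.
Proof.
move=> eta_gt0 XK st; exists K => //.
have := st 0; rewrite oppr_lt0 eta_gt0 => /(_ isT).
by rewrite /expNi cos0 sin0 oppr0.
Qed.

Lemma gain_margin_pinfty (R : realType) (X : controller_type) (P : plant R)
    (K : controller R) :
  of_type X K -> (forall alpha : R, 1 <= alpha -> stabilizes K alpha%:C P) ->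
  is_gain_margin X P +oo%E.
Proof.
move=> XK st; split; first by exists K => //; exact: (st 1).
apply: hasNub_ereal_sup; last first.
  by exists 0; exists K => // alpha /andP[/st].
move=> [M ubM]; suff : M + 1 <= M by lra.
by apply: ubM; exists K => // alpha /andP[/st].
Qed.

(** The controller may depend on [eta < t], so the supremum need not be attained. *)
Lemma phase_marginP (R : realType) (X : controller_type) (P : plant R) (t : R) :
  0 < t <= pi ->
  (forall eta, 0 <= eta < t -> exists2 K, of_type X K &
     forall theta, - eta < theta < eta -> stabilizes K (expNi theta) P) ->
  (forall eta K, t < eta <= pi -> of_type X K ->
     ~ (forall theta, - eta < theta < eta -> stabilizes K (expNi theta) P)) ->
  is_phase_margin X P t.
Proof.
move=> /andP[t_gt0 t_pi] low up.
split.
  have [|K XK st] := low (t / 2); first lra.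
  by apply: stabilizable_of_phase_range XK st; lra.
rewrite /phase_margin; set E := (X in sup X).
have E0 : E 0.
  split; first by rewrite lexx pi_ge0.
  have [|K XK _] := low 0; first lra.
  by exists K => // theta; lra.
have ubE : ubound E t.
  move=> eta [/andP[eta0 eta_pi] [K XK st]].
  rewrite leNgt; apply/negP => t_eta.
  by apply: (up eta K) => //; rewrite t_eta.
apply/eqP; rewrite eq_le ge_sup //=; last by exists 0.
rewrite leNgt; apply/negP => supE.
have sup0 : 0 <= sup E by apply: ub_le_sup => //; exists t.
(* The midpoint lies below [t], hence in [E], yet above [sup E]. *)
pose eta := (sup E + t) / 2.
suff : eta <= sup E by rewrite /eta; lra.
apply: ub_le_sup; first by exists t.
split; first by rewrite /eta; lra.
by apply: low; rewrite /eta; lra.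
Qed.

(** * Stabilizing gains and the obstruction at [pi / 2] *)

(** The condition [b0 * kd = 0] makes the closed loop monic; it covers both proportional control and
    PD control of a plant with constant numerator. *)
Lemma stabilizes_PD_Hurwitz (R : realType) (kp kd a b b0 b1 : R)
    (c p1 p2 : R[i]) :
  ('X - p1%:P) * ('X - p2%:P) = 'X^2 - a%:C%:P * 'X + b%:C%:P ->
  b0 * kd = 0 ->
  let C := complex.Re c in let S := complex.Im c in
  let g := b0 * kp + b1 * kd in
  0 < - a + g * C ->
  (b1 * kp * S) ^+ 2 < (- a + g * C) *
    ((- a + g * C) * (b + b1 * kp * C) + g * S * (b1 * kp * S)) ->
  stabilizes (K_PD kp kd) c (second_order_plant b0 b1 p1 p2).
Proof.
move=> denE kd0 C S g A_gt0 det_gt0.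
apply: (stabilizes_PD denE) => [|z]; first by rewrite kd0 mulr0 addr0 oner_eq0.
have kdC : b0%:C * kd%:C = 0 :> R[i] by rewrite -rmorphM /= kd0.
move=> Ez; pose A := - a%:C + c * g%:C; pose B := b%:C + c * (b1 * kp)%:C.
apply: (@complex_quadratic_Hurwitz R A B).
- by rewrite /A; move: A_gt0; rewrite /C; case: (c) => u v /=; lra.
- rewrite /A /B; move: det_gt0; rewrite /C /S; case: (c) => u v /=.
  rewrite !mulr0 !subr0 !add0r oppr0 add0r.
  by rewrite !(mulrC u) !(mulrC v).
rewrite -Ez /A /B /g !rmorphD !rmorphM /=.
have -> : z ^+ 2 - a%:C * z + b%:C
    + c * ((b0%:C * z + b1%:C) * (kp%:C + kd%:C * z))
  = z ^+ 2 - a%:C * z + b%:C + c * (b0%:C * kp%:C * z + b1%:C * kp%:C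
      + b1%:C * kd%:C * z + b0%:C * kd%:C * z ^+ 2) by ring.
by rewrite kdC; ring.
Qed.

Lemma high_gain_PD_stabilizes (R : realType) (a b b0 b1 : R) (p1 p2 : R[i]) :
  ('X - p1%:P) * ('X - p2%:P) = 'X^2 - a%:C%:P * 'X + b%:C%:P ->
  0 < a -> 0 < b -> 0 < b0 -> 0 < b1 ->
  exists2 K : controller R, of_type TypePD K &
    forall c : R[i], complex.Re c ^+ 2 + complex.Im c ^+ 2 = 1 ->
      stabilizes K c (second_order_plant b0 b1 p1 p2).
Proof.
move=> denE a_gt0 b_gt0 b0_gt0 b1_gt0.
have t1 : 0 < 2 / b0 ^+ 2 by rewrite divr_gt0 ?exprn_gt0.
have t2 : 0 < 2 * b / b1 ^+ 2 by rewrite divr_gt0 ?exprn_gt0 // mulr_gt0.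
have t3 : 0 < 2 * a / (b0 * b1) by rewrite divr_gt0 // mulr_gt0.
pose k := 2 / b0 ^+ 2 + 2 * b / b1 ^+ 2 + 2 * a / (b0 * b1).
have k0 : 2 <= k * b0 ^+ 2 by rewrite -ler_pdivrMr ?exprn_gt0 // /k; lra.
have k1 : 2 * b <= k * b1 ^+ 2 by rewrite -ler_pdivrMr ?exprn_gt0 // /k; lra.
have k2 : 2 * a <= k * (b0 * b1) by rewrite -ler_pdivrMr ?mulr_gt0 // /k; lra.
exists (K_PD (k * b1) (k * b0)); first by exists (k * b1), (k * b0).
move=> c c1; apply: (stabilizes_PD denE).
  (* The leading coefficient is [1 + m c] with [m >= 2] and [c] of modulus 1, so it cannot
     vanish. *)
  apply/negP; move: c1; case: (c) => C S /= CS.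
  rewrite eq_complex /= => /andP[/eqP eC /eqP eS].
  have m0 : 2 <= b0 * (k * b0) by move: k0; lra.
  set m := b0 * _ in m0 eC eS.
  have : m ^+ 2 = (m * C) ^+ 2 + (m * S) ^+ 2 by rewrite !exprMn -mulrDr CS mulr1.
  have -> : m * C = -1 by lra.
  have -> : m * S = 0 by lra.
  nra.
move=> z Ez; apply: (@high_gain_square_root_lt0 R a b b0 b1 k c) => //.
- by rewrite /k; lra.
- by rewrite gtr0_norm.
by rewrite -Ez !rmorphM /=; ring.
Qed.

Lemma cos_ge_of_norm_lt (R : realType) (eta theta : R) :
  eta <= pi -> - eta < theta < eta -> cos eta <= cos theta.
Proof.
move=> eta_pi; rewrite -ltr_norml => th; rewrite -(cos_norm theta).
have th0 := normr_ge0 theta.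
by apply: ltW; rewrite ltr_cos // in_itv /=; lra.
Qed.

(** At [theta = pi / 2], inside the open range only if [pi / 2 < eta], [Re c = 0] and the pole-sum
    bound becomes [a <= 0]. *)
Lemma no_phase_above_pihalf (R : realType) (a b b0 b1 eta : R) (Q : {poly R})
    (K : controller R) (p1 p2 : R[i]) :
  ('X - p1%:P) * ('X - p2%:P) = 'X^2 - a%:C%:P * 'X + b%:C%:P -> 0 < a ->
  K = tofrac Q / tofrac 'X ->
  (size ((b0 *: 'X + b1%:P) * Q)%R <= 3)%N -> pi / 2 < eta ->
  ~ (forall theta, - eta < theta < eta ->
       stabilizes K (expNi theta) (second_order_plant b0 b1 p1 p2)).
Proof.
move=> denE a_gt0 KE szQ eta_gt /(_ (pi / 2)).
have := pi_gt0 R => pi_gt0 st.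
have {}st := st ltac:(lra).
have := stabilizes_pole_sum_le denE KE szQ st.
by rewrite /= cos_pihalf mul0r; lra.
Qed.

Lemma K_P_fraction (R : realType) (kp : R) :
  K_P kp = tofrac (kp%:P * 'X) / tofrac 'X.
Proof. by rewrite K_P_PD K_PD_PID K_PID_fraction !polyC0 add0r mul0r addr0. Qed.

Lemma size_num_P (R : realType) (b0 b1 kp : R) :
  (size ((b0 *: 'X + b1%:P) * (kp%:P * 'X))%R <= 3)%N.
Proof.
have -> : (b0 *: 'X + b1%:P) * (kp%:P * 'X) =
    ((b0 * kp)%:P * 'X + (b1 * kp)%:P) * 'X + 0%:P :> {poly R}.
  by rewrite -mul_polyC polyC0 !polyCM; ring.
rewrite !size_MXaddC; do 2 case: ifP => // _.
by rewrite !ltnS size_polyC_leq1.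
Qed.

(** A constant plant numerator keeps the degree at 2; a nonzero slope with [kd != 0] would give 3,
    beyond the reach of the pole-sum bound. *)
Lemma size_num_PID (R : realType) (b1 kp ki kd : R) :
  (size ((0 *: 'X + b1%:P) * (ki%:P + kp%:P * 'X + kd%:P * 'X^2))%R <= 3)%N.
Proof.
have -> : (0 *: 'X + b1%:P) * (ki%:P + kp%:P * 'X + kd%:P * 'X^2) =
    ((b1 * kd)%:P * 'X + (b1 * kp)%:P) * 'X + (b1 * ki)%:P :> {poly R}.
  by rewrite scale0r !polyCM; ring.
rewrite !size_MXaddC; do 2 case: ifP => // _.
by rewrite !ltnS size_polyC_leq1.
Qed.

(** * Values of the margins *)

Theorem theorem4p1 (R : realType) (beta0 beta1 : R) (p1 p2 : R[i])
  (hbeta0 : 0 <= beta0) (hbeta1 : 0 < beta1)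
  (hp1 : 0 < complex.Re p1) (hp2 : 0 < complex.Re p2)
  (hp12 : (complex.Im p1 = 0 /\ complex.Im p2 = 0) \/ p2 = conjc p1) :
  let P := second_order_plant beta0 beta1 p1 p2 in
  ((beta0 = 0 ->
      ~ stabilizable TypeP P /\ ~ (exists k : \bar R, is_gain_margin TypeP P k))
   /\ (beta0 <> 0 -> is_gain_margin TypeP P +oo%E)
   /\ is_gain_margin TypePID P +oo%E
   /\ is_gain_margin TypePD P +oo%E)
  /\
  ((beta0 = 0 ->
      [/\ ~ stabilizable TypeP P,
          ~ (exists t : R, is_phase_margin TypeP P t),
          is_phase_margin TypePID P (pi / 2)
        & is_phase_margin TypePD P (pi / 2)])
   /\ (beta0 <> 0 ->
      [/\ is_phase_margin TypeP P (pi / 2),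
          is_phase_margin TypePID P pi
        & is_phase_margin TypePD P pi])).
Proof.
move=> P; have [a [b [a_gt0 b_gt0 denE]]] := second_order_denE hp1 hp2 hp12.
have pi_gt0 := pi_gt0 R.
have pihalf : 0 < (pi : R) / 2 <= pi by apply/andP; split; lra.
have noP : beta0 = 0 -> ~ stabilizable TypeP P.
  move=> beta00 [_ [kp ->] st].
  have := stabilizes_pole_sum_le denE (K_P_fraction kp) (size_num_P _ _ _) st.
  rewrite beta00 scale0r add0r mulrA -polyCM coefCM coefX /= mulr0 mulr0; lra.
(* For real [alpha] the Hurwitz conditions reduce to [- a + g * alpha] and [b + beta1 * kp * alpha]
   being positive. *)
have gainPD g kp kd : 0 <= kp -> beta0 * kd = 0 ->
    g = beta0 * kp + beta1 * kd -> a < g ->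
    forall alpha, 1 <= alpha -> stabilizes (K_PD kp kd) alpha%:C P.
  move=> kp_ge0 kd0 -> a_lt alpha alpha1.
  have ga : 0 < - a + (beta0 * kp + beta1 * kd) * alpha by nra.
  apply: (stabilizes_PD_Hurwitz denE) => //=.
  rewrite !mulr0 expr0n /= addr0 !mulr_gt0 // ltr_wpDr // !mulr_ge0 //; lra.
have gainP : beta0 <> 0 -> exists2 K, of_type TypeP K &
    forall alpha : R, 1 <= alpha -> stabilizes K alpha%:C P.
  (* This gain makes [g = 2 * a]. *)
  move=> /eqP beta0N; exists (K_P (2 * a / beta0)); first by eexists.
  rewrite K_P_PD; apply: (gainPD (2 * a)).
  - by rewrite divr_ge0 // mulr_ge0 // ltW.
  - by rewrite mulr0.
  - by field.
  - lra.
have gain : exists2 K, of_type TypePD K &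
    forall alpha : R, 1 <= alpha -> stabilizes K alpha%:C P.
  have [beta00|/eqP beta0N] := eqVneq beta0 0; last first.
    by have [K KP st] := gainP beta0N; exists K => //; exact: of_type_P_PD.
  exists (K_PD 0 (2 * a / beta1)); first by eexists; eexists.
  apply: (gainPD (2 * a)) => //.
  - by rewrite beta00 mul0r.
  - by field; rewrite gt_eqF.
  - lra.
have lowPD : beta0 = 0 -> forall eta, 0 <= eta < pi / 2 ->
    exists2 K, of_type TypePD K & forall theta, - eta < theta < eta ->
      stabilizes K (expNi theta) P.
  move=> beta00 eta eta_bnd.
  have ceta : 0 < cos eta by apply: cos_gt0_pihalf; lra.
  (* This [kd] keeps [g * cos theta >= 2 * a] on the range; with [kp = 0] the constant term is the
     real [b], so the determinant is positive. *)
  exists (K_PD 0 (2 * a / (beta1 * cos eta))); first by eexists; eexists.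
  move=> theta th; have cth : cos eta <= cos theta.
    by apply: cos_ge_of_norm_lt th; lra.
  have g_ge0 : 0 <= 2 * a / cos eta by rewrite divr_ge0 ?ltW // mulr_gt0.
  have gE : beta0 * 0 + beta1 * (2 * a / (beta1 * cos eta)) = 2 * a / cos eta.
    by field; rewrite !gt_eqF.
  have A_gt0 : 0 < - a + 2 * a / cos eta * cos theta.
    have := ler_wpM2l g_ge0 cth; rewrite divfK ?gt_eqF //; lra.
  apply: (stabilizes_PD_Hurwitz denE); rewrite /= ?gE //.
    by rewrite beta00 mul0r.
  by rewrite !(mulr0, mul0r) expr0n !addr0 /= !mulr_gt0.
have lowP : beta0 <> 0 -> forall eta, 0 <= eta < pi / 2 ->
    exists2 K, of_type TypeP K & forall theta, - eta < theta < eta ->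
      stabilizes K (expNi theta) P.
  move=> /eqP beta0N eta eta_bnd.
  have beta0_gt0 : 0 < beta0 by rewrite lt_def beta0N.
  have ceta : 0 < cos eta by apply: cos_gt0_pihalf; lra.
  have [k k_gt0 kP] := Routh_gain_exists a_gt0 b_gt0 beta0_gt0 hbeta1 ceta.
  exists (K_P k); first by exists k.
  move=> theta th; have cth : cos eta <= cos theta.
    by apply: cos_ge_of_norm_lt th; lra.
  have [|A_gt0 det_gt0] := kP _ (- sin theta) cth.
    by rewrite sqrrN cos2Dsin2.
  rewrite K_P_PD; apply: (stabilizes_PD_Hurwitz denE); rewrite ?mulr0 //=.
    by rewrite addr0 (mulrC beta0).
  by rewrite addr0 !(mulrC _ k).
have lowpi : beta0 <> 0 -> exists2 K, of_type TypePD K &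
    forall theta, stabilizes K (expNi theta) P.
  move=> /eqP beta0N.
  have beta0_gt0 : 0 < beta0 by rewrite lt_def beta0N.
  have [K KPD st] := high_gain_PD_stabilizes denE a_gt0 b_gt0 beta0_gt0 hbeta1.
  by exists K => // theta; apply: st; rewrite /= sqrrN cos2Dsin2.
have upPID : beta0 = 0 -> forall eta K,
    pi / 2 < eta <= pi -> of_type TypePID K ->
    ~ (forall theta, - eta < theta < eta -> stabilizes K (expNi theta) P).
  move=> beta00 eta K /andP[eta_gt _] [kp [ki [kd KE]]].
  apply: (no_phase_above_pihalf denE a_gt0 _ _ eta_gt).
    by rewrite KE K_PID_fraction.
  by rewrite beta00 size_num_PID.
split; [split; [|split; [|split]] | split].
- by move=> beta00; split; [exact: noP | case=> k [/(noP beta00)]].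
- by move=> /gainP[K KP st]; exact: gain_margin_pinfty KP st.
- have [K KPD st] := gain.
  by apply: gain_margin_pinfty st; exact: of_type_PD_PID.
- by have [K KPD st] := gain; exact: gain_margin_pinfty KPD st.
- move=> beta00; split; first exact: noP.
  + by case=> t [/(noP beta00)].
  + apply: phase_marginP => //; last exact: upPID.
    move=> eta /(lowPD beta00)[K KPD st].
    by exists K => //; exact: of_type_PD_PID.
  + apply: phase_marginP => //; first exact: lowPD.
    by move=> eta K eta_bnd /of_type_PD_PID; exact: upPID.
- move=> beta0N; have [Kpi KpiPD stpi] := lowpi beta0N; split.
  + apply: phase_marginP => //; first exact: lowP.
    move=> eta _ /andP[eta_gt _] [kp ->].
    exact: (no_phase_above_pihalf denE a_gt0 (K_P_fraction kp)
      (size_num_P _ _ _) eta_gt).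
  (* For [t = pi] the upper condition is vacuous. *)
  + apply: phase_marginP; first by rewrite pi_gt0 lexx.
      by move=> eta _; exists Kpi => //; exact: of_type_PD_PID.
    by move=> eta K; lra.
  + apply: phase_marginP; first by rewrite pi_gt0 lexx.
      by move=> eta _; exists Kpi.
    by move=> eta K; lra.
Qed.
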